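(* For every odd integer $k\geq 5$ and every integer $n\geq 2$, $$Q(n,k)\geq 2^{\left(\frac{k-3}{2}\right)^{\lfloor\frac{n-1}{2}\rfloor}\left(\frac{k-1}{2}\right)^{\lceil\frac{n+1}{2}\rceil}}>2^{\left(\frac{k-3}{2}\right)^{n/2}\left(\frac{k-1}{2}\right)^{n/2}}.$$
   Context: An $n$-ary quasigroup of order $k$ is a function $f:\Sigma^n\to\Sigma$, where $\Sigma=\{0,1,\dots,k-1\}$, such that fixing any $n-1$ of its arguments to arbitrary values of $\Sigma$ yields a bijection $\Sigma\to\Sigma$ in the remaining argument. $Q(n,k)$ denotes the number of distinct $n$-ary quasigroups of order $k$ on the fixed set $\Sigma=\{0,1,\dots,k-1\}$. *)

(* Defs.v *)
From mathcomp Require Import all_boot.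
From Stdlib Require Import Reals.
From mathcomp Require Import boolp.
Set Implicit Arguments. Unset Strict Implicit. Unset Printing Implicit Defensive.

Definition nary_op (n k : nat) := {ffun {ffun 'I_n -> 'I_k} -> 'I_k}.

Definition upd (n k : nat) (x : {ffun 'I_n -> 'I_k}) (i : 'I_n) (a : 'I_k)
  : {ffun 'I_n -> 'I_k} := [ffun j => if j == i then a else x j].

Definition is_quasigroup (n k : nat) (f : nary_op n k) : Prop :=
  forall (i : 'I_n) (x : {ffun 'I_n -> 'I_k}), bijective (fun a => f (upd x i a)).

Definition Q (n k : nat) : nat :=
  #|[set f : nary_op n k | `[< is_quasigroup f >] ]|.

(* Main.v *)
Require Import Defs.
From mathcomp Require Import all_boot boolp all_fingroup all_algebra zify ring.
Set Implicit Arguments. Unset Strict Implicit. Unset Printing Implicit Defensive.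

(** If F is an n-ary quasigroup and {a, b} a pair of values, then a and b can be
    swapped independently on each connected component (in the Hamming graph) of
    F^-1({a, b}).  Suppose a Latin square of order k has M disjoint pairs of
    symbols such that the cells holding pair j split into m intercalates, whose
    rows and columns are again pairs, and at least one further component.  If F
    and G have N1 and N2 components for every pair, then F x * G y has at least
    m N1 N2 + 1.

    For k = 2m + 3 >= 7 and M = m + 1, such a square is obtained from an
    idempotent Latin square of order M by replacing the off-diagonal cells by
    2 x 2 subsquares and filling the diagonal blocks and one new row and column
    with copies of Z/3.  Composing with binary factors yields
    m^((n-1)/2) M^(n/2) components for each of the M pairs.

    For k = 5 there is no idempotent Latin square of order 2.  A square with an
    order-2 subsquare gives one pair only, with N(n + 4) = 5 N(n) + 1 components;
    the missing factor for small n comes from permuting the first two arguments.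
*)

(** * Latin squares and n-ary quasigroups on sequences of arguments *)

Definition latin (T : Type) (op : T -> T -> T) :=
  (forall a, injective (op a)) /\ (forall b, injective (op^~ b)).

Section NaryOperations.

Variable S : finType.

Definition agree_off (i : nat) (x y : nat -> S) := forall j, j != i -> x j = y j.

(** Arguments are infinite sequences of which only the first n entries matter, so that arities add
    without casts between ordinal types. *)
Definition depends_below (A : Type) (n : nat) (F : (nat -> S) -> A) :=
  forall x y, (forall i, i < n -> x i = y i) -> F x = F y.

Definition nquasi (n : nat) (F : (nat -> S) -> S) :=
  depends_below n F /\
  forall i x y, i < n -> agree_off i x y -> F x = F y -> x i = y i.

Definition set_coord (x : nat -> S) (i : nat) (a : S) (j : nat) : S :=
  if j == i then a else x j.

Definition shift (n : nat) (x : nat -> S) (i : nat) : S := x (n + i).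

Definition glue (n : nat) (x y : nat -> S) (i : nat) : S :=
  if i < n then x i else y (i - n).

Lemma agree_off_set_coord x i a b : agree_off i (set_coord x i a) (set_coord x i b).
Proof. by move=> j /negbTE ji; rewrite /set_coord ji. Qed.

Lemma agree_off_below A n (F : (nat -> S) -> A) i x y :
  depends_below n F -> n <= i -> agree_off i x y -> F x = F y.
Proof. by move=> dF ni xy; apply: dF => j jn; apply: xy; lia. Qed.

Lemma agree_off_shift n i x y :
  n <= i -> agree_off i x y -> agree_off (i - n) (shift n x) (shift n y).
Proof. by move=> ni xy j ji; apply: xy; lia. Qed.

Lemma shift_eq n i x y : i < n -> agree_off i x y -> shift n x =1 shift n y.
Proof. by move=> ilt xy j; apply: xy; lia. Qed.

Lemma glue_shift n x y : shift n (glue n x y) =1 y.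
Proof. by move=> i; rewrite /shift /glue ltnNge leq_addr /= addKn. Qed.

Lemma depends_glue A n (F : (nat -> S) -> A) x y :
  depends_below n F -> F (glue n x y) = F x.
Proof. by move=> dF; apply: dF => i ilt; rewrite /glue ilt. Qed.

Lemma depends_ext A n (F : (nat -> S) -> A) x y : depends_below n F -> x =1 y -> F x = F y.
Proof. by move=> dF xy; apply: dF => i _. Qed.

Lemma nquasi_surj n F : 0 < n -> nquasi n F -> forall a, exists x, F x = a.
Proof.
move=> n0 [_ injF] a.
have inj : injective (fun s => F (set_coord (fun=> a) 0 s)).
  move=> s t /(injF 0 _ _ n0 (@agree_off_set_coord _ _ _ _)).
  by rewrite /set_coord eqxx.
by exists (set_coord (fun=> a) 0 (invF inj a)); rewrite (f_invF inj).
Qed.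

Lemma Q_ge_card (n : nat) (T : finType) (A : {set T}) (Phi : T -> (nat -> S) -> S) :
  0 < #|S| ->
  {in A, forall t, nquasi n (Phi t)} ->
  {in A &, forall t t', (forall x, Phi t x = Phi t' x) -> t = t'} ->
  #|A| <= Q n #|S|.
Proof.
move=> /card_gt0P [s0 _] qPhi injPhi.
(* The padding by [s0] is harmless, as [Phi t] ignores entries from n on. *)
pose ext (x : {ffun 'I_n -> 'I_#|S|}) (i : nat) : S :=
  if insub i is Some i' then enum_val (x i') else s0.
have extE x (i : 'I_n) : ext x i = enum_val (x i) by rewrite /ext valK.
pose op t : nary_op n #|S| := [ffun x => enum_rank (Phi t (ext x))].
have opinj : {in A &, injective op}.
  move=> t t' At At' /ffunP eq_op; apply: injPhi => // x.
  have /(congr1 enum_val) := eq_op [ffun i : 'I_n => enum_rank (x i)].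
  rewrite !ffunE !enum_rankK.
  have [[dt _] [dt' _]] := (qPhi t At, qPhi t' At').
  have eqx i : i < n -> ext [ffun i : 'I_n => enum_rank (x i)] i = x i.
    by move=> ilt; rewrite (extE _ (Ordinal ilt)) ffunE enum_rankK.
  by rewrite (dt _ x) // (dt' _ x).
rewrite -(card_in_imset opinj); apply: subset_leq_card.
apply/subsetP => _ /imsetP [t At ->]; rewrite inE; apply/asboolP => i x.
apply: injF_bij => a b; rewrite !ffunE => /enum_rank_inj eqF.
have [_ /(_ i _ _ (ltn_ord i) _ eqF)] := qPhi t At.
rewrite !extE !ffunE eqxx => H; apply: enum_val_inj; apply: H => j ji.
rewrite /ext; case: insubP => // j' _ vj; rewrite !ffunE; case: eqP => // j'i.
by move: ji; rewrite -vj j'i eqxx.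
Qed.

End NaryOperations.

(** * Components over pairs of values, their composition and switching *)

Section Components.

Variables (S J : finType) (pi : S -> option J).

(* [col j] names the components of F^-1(pair j): it is constant along lines
   inside this preimage, and every colour is attained there. *)
Definition colored (n : nat) (C : Type) (F : (nat -> S) -> S) (col : J -> (nat -> S) -> C) :=
  [/\ nquasi n F,
      forall j, depends_below n (col j),
      forall j i x y, agree_off i x y ->
        pi (F x) = Some j -> pi (F y) = Some j -> col j x = col j y
    & forall j c, exists x, pi (F x) = Some j /\ col j x = c].

Definition has_colored (n N : nat) :=
  exists (C : finType) F (col : J -> (nat -> S) -> C), colored n F col /\ #|C| = N.

Lemma has_colored1 : (forall j, exists s, pi s = Some j) -> has_colored 1 1.
Proof.
move=> pi_surj; exists unit, (fun x => x 0), (fun _ _ => tt).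
split; last by rewrite card_unit.
split=> //.
- by split=> [x y|[|//] x y _ _] //; apply.
- by move=> j []; have [s sj] := pi_surj j; exists (fun=> s).
Qed.

Variables (E : finType) (star : S -> S -> S) (U V : J -> E -> J).
Variable e : J -> S -> S -> option E.

(* [e j a b] is the block of pair j containing the cell (a, b), with row pair
   [U j i] and column pair [V j i]; [None] collects the remaining cells of pair j. *)
Definition blocks :=
  [/\ latin star,
      forall j a b b', pi (star a b) = Some j -> pi (star a b') = Some j ->
        e j a b = e j a b',
      forall j a a' b, pi (star a b) = Some j -> pi (star a' b) = Some j ->
        e j a b = e j a' b,
      forall j a b i, pi (star a b) = Some j -> e j a b = Some i ->
        pi a = Some (U j i) /\ pi b = Some (V j i)
    & (forall j i a b, pi a = Some (U j i) -> pi b = Some (V j i) ->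
        pi (star a b) = Some j /\ e j a b = Some i) /\
      (forall j, exists a b, pi (star a b) = Some j /\ e j a b = None)].

(** A line moves only one factor, hence stays in one block; inside block i the values of F and G
    remain in the pairs [U j i] and [V j i], so their colours are constant too. All cells outside
    the blocks share the colour [None]. *)
Lemma has_colored_star n1 n2 N1 N2 :
  blocks -> 0 < n1 -> 0 < n2 -> has_colored n1 N1 -> has_colored n2 N2 ->
  has_colored (n1 + n2) (#|E| * N1 * N2).+1.
Proof.
move=> [[starL starR] eL eR eP [eUV eN]] n1_gt0 n2_gt0.
move=> [C1 [F [c1 [[[dF iF] dc1 lc1 sc1] <-]]]] [C2 [G [c2 [[[dG iG] dc2 lc2 sc2] <-]]]].
exists (option (E * C1 * C2)), (fun x => star (F x) (G (shift n1 x))).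
exists (fun j x => if e j (F x) (G (shift n1 x)) is Some i
  then Some (i, c1 (U j i) x, c2 (V j i) (shift n1 x)) else None).
split; last by rewrite card_option !card_prod.
have dS A (H : (nat -> S) -> A) x y : depends_below n2 H ->
    (forall i, i < n1 + n2 -> x i = y i) -> H (shift n1 x) = H (shift n1 y).
  by move=> dH xy; apply: dH => i ilt; apply: xy; rewrite ltn_add2l.
have dL A (H : (nat -> S) -> A) x y : depends_below n1 H ->
    (forall i, i < n1 + n2 -> x i = y i) -> H x = H y.
  by move=> dH xy; apply: dH => i ilt; apply: xy; apply: ltn_addr.
split.
- split=> [x y xy|i x y ilt xy]; first by rewrite (dL _ F x y) // (dS _ G x y).
  have [i_n1|n1_i] := ltnP i n1.
    rewrite (depends_ext dG (shift_eq i_n1 xy)) => /starR; exact: iF.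
  rewrite (agree_off_below dF n1_i xy) => /starL /(iG _ _ _ _ (agree_off_shift n1_i xy)).
  by rewrite /shift subnKC //; apply; lia.
- move=> j x y xy; rewrite (dL _ F x y) // (dS _ G x y) //.
  by case: (e _ _ _) => // i; rewrite (dL _ (c1 _) x y) // (dS _ (c2 _) x y).
- move=> j i x y xy; have [i_n1|n1_i] := ltnP i n1.
    have xyS := shift_eq i_n1 xy.
    rewrite (depends_ext dG xyS) => Px Py; rewrite (eR _ _ _ _ Px Py).
    case Ey: (e _ _ _) => [l|//].
    have [Uy _] := eP _ _ _ _ Py Ey.
    have [Ux _] := eP _ _ _ _ Px (etrans (eR _ _ _ _ Px Py) Ey).
    by rewrite (lc1 _ _ _ _ xy Ux Uy) (depends_ext (dc2 _) xyS).
  rewrite (agree_off_below dF n1_i xy) => Px Py; rewrite (eL _ _ _ _ Px Py).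
  case Ey: (e _ _ _) => [l|//].
  have [_ Vy] := eP _ _ _ _ Py Ey.
  have [_ Vx] := eP _ _ _ _ Px (etrans (eL _ _ _ _ Px Py) Ey).
  by rewrite (lc2 _ _ _ _ (agree_off_shift n1_i xy) Vx Vy) (agree_off_below (dc1 _) n1_i xy).
- move=> j [[[i p] q]|].
    have [[x [Fx <-]] [y [Gy <-]]] := (sc1 (U j i) p, sc2 (V j i) q).
    exists (glue n1 x y).
    have [? E1] := eUV _ _ _ _ Fx Gy.
    rewrite (depends_glue _ _ dF) (depends_ext dG (glue_shift _ _ _)) E1.
    by rewrite (depends_glue _ _ (dc1 _)) (depends_ext (dc2 _) (glue_shift _ _ _)).
  have [a [b [ab E1]]] := eN j.
  have [x Fx] := nquasi_surj n1_gt0 (conj dF iF) a.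
  have [y Gy] := nquasi_surj n2_gt0 (conj dG iG) b.
  exists (glue n1 x y).
  by rewrite (depends_glue _ _ dF) (depends_ext dG (glue_shift _ _ _)) Fx Gy E1.
Qed.

Variable sw : S -> S.

Definition swaps_pairs :=
  [/\ injective sw, forall s, pi (sw s) = pi s & forall s j, pi s = Some j -> sw s != s].

Definition switch (C : finType) (F : (nat -> S) -> S) (col : J -> (nat -> S) -> C)
    (D : {set J * C}) (x : nat -> S) : S :=
  if pi (F x) is Some j then if (j, col j x) \in D then sw (F x) else F x else F x.

(** Switching preserves [pi], so equal values on a line come from F-values in the same pair or
    outside all pairs; in the former case the colours agree and [sw] acts on both values or on
    neither. *)
Lemma nquasi_switch n (C : finType) F (col : J -> (nat -> S) -> C) D :
  swaps_pairs -> colored n F col -> nquasi n (switch F col D).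
Proof.
move=> [sw_inj pi_sw _] [[dF iF] dcol lcol _]; split=> [x y xy|i x y ilt xy].
  rewrite /switch (dF _ _ xy); case: (pi _) => // j.
  by rewrite (dcol _ _ _ xy).
have piE z : pi (switch F col D z) = pi (F z).
  by rewrite /switch; case E1: (pi (F z)) => [j|//]; case: ifP; rewrite ?pi_sw.
move=> eqD; have := congr1 pi eqD; rewrite !piE => eq_pi.
apply: (iF _ _ _ ilt xy); move: eqD; rewrite /switch eq_pi.
case Ey: (pi (F y)) eq_pi => [j|//] Ex.
by rewrite (lcol _ _ _ _ xy Ex Ey); case: ifP => // _ /sw_inj.
Qed.

Lemma switch_inj n (C : finType) F (col : J -> (nat -> S) -> C) D D' :
  swaps_pairs -> colored n F col ->
  (forall x, switch F col D x = switch F col D' x) -> D = D'.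
Proof.
move=> [_ _ sw_neq] [_ _ _ scol] eqD; apply/setP => -[j c].
have [x [Fx <-]] := scol j c; move: (eqD x); rewrite /switch Fx.
have /eqP sw_neqx := sw_neq _ _ Fx.
case: ifP => _; case: ifP => _ //; congruence.
Qed.

Lemma Q_ge_switch n N :
  swaps_pairs -> 0 < #|S| -> has_colored n N -> 2 ^ (#|J| * N) <= Q n #|S|.
Proof.
move=> swP S0 [C [F [col [Fcol <-]]]].
rewrite -card_prod -(cardsT (J * C)%type) -card_powerset.
apply: (Q_ge_card (Phi := switch F col)) => // [D _|D D' _ _].
  exact: nquasi_switch.
exact: switch_inj Fcol.
Qed.

End Components.

(** * Idempotent Latin squares of every order at least 3 *)

Section IdempotentLatinSquares.

Definition idem_latin (T : Type) (op : T -> T -> T) := latin op /\ forall a, op a a = a.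

Lemma idem_latin_ord (T : finType) (op : T -> T -> T) :
  idem_latin op -> exists op' : 'I_#|T| -> 'I_#|T| -> 'I_#|T|, idem_latin op'.
Proof.
move=> [[opL opR] opI].
exists (fun a b => enum_rank (op (enum_val a) (enum_val b))); split; last first.
  by move=> a; rewrite opI enum_valK.
by split=> [a b b'|b a a'] /enum_rank_inj; [move/opL | move/opR]; apply: enum_val_inj.
Qed.

Import GRing.Theory.

Lemma half_Zp q : (2%:R * q.+2%:R = 1 :> 'I_q.*2.+3)%R.
Proof.
rewrite -natrM; apply: val_inj; rewrite Zp_nat /=.
by rewrite (_ : 2 * q.+2 = q.*2.+3 + 1) ?modnDl //; lia.
Qed.

Lemma idem_latin_half (R : comNzRingType) (h : R) :
  (2%:R * h = 1)%R -> idem_latin (fun a b => h * (a + b))%R.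
Proof.
move=> h2.
have hI : injective ( *%R h).
  by move=> a b /(congr1 ( *%R 2%:R)); rewrite !mulrA h2 !mul1r.
split; last by move=> a; rewrite -mulr2n -mulr_natl mulrA (mulrC h) h2 mul1r.
by split=> [a b b'|b a a'] /hI; [apply: addrI | apply: addIr].
Qed.

(* The prolongation of the square h (a + b) along the transversal b = a + 1. *)
Lemma idem_latin_prolong (R : comNzRingType) (h : R) :
  (2%:R * h = 1)%R -> exists op : option R -> option R -> option R, idem_latin op.
Proof.
move=> h2; have [[opL opR] opI] := idem_latin_half h2.
(* The entry displaced from the transversal cell (a, a + 1) moves to the new column in row a, and to
   the new row in column a + 1. *)
have h1 (a : R) : (h * (a + (a + 1)) = a + h)%R.
  by transitivity (2%:R * h * a + h)%R; [ring | rewrite h2 mul1r].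
have h1' (a : R) : (h * ((a - 1) + a) = a - h)%R.
  by transitivity (2%:R * h * a - h)%R; [ring | rewrite h2 mul1r].
exists (fun a b => match a, b with
  | Some a, Some b => if b == (a + 1)%R then None else Some (h * (a + b))%R
  | Some a, None => Some (a + h)%R
  | None, Some b => Some (b - h)%R
  | None, None => None
  end).
split; last first.
  (* The transversal misses the diagonal because 1 is nonzero. *)
  by move=> [a|] //; rewrite eq_sym -subr_eq0 addrAC subrr add0r oner_eq0 opI.
split=> [[a|] [b|] [b'|] //|[b|] [a|] [a'|] //] /=.
- by case: eqP => [->|_]; case: eqP => [->|_] // [/opL ->].
- by case: eqP => // nb [/esym]; rewrite -h1 => /opL /esym.
- by case: eqP => // nb []; rewrite -h1 => /opL /esym.
- by move=> [/addIr ->].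
- case: eqP => [->|_]; first by case: eqP => // /addIr ->.
  by case: eqP => // _ [/opR ->].
- by case: eqP => // nb []; rewrite -h1' => /opR ab; case: nb; rewrite ab subrK.
- by case: eqP => // nb [/esym]; rewrite -h1' => /opR ab; case: nb; rewrite ab subrK.
- by move=> [/addIr ->].
Qed.

(** For even m, halving works modulo m + 1; for odd m, the square modulo m is prolonged. *)
Lemma exists_idem_latin m : 1 < m -> exists op : 'I_m.+1 -> 'I_m.+1 -> 'I_m.+1, idem_latin op.
Proof.
move=> m_gt1; have [m_odd|m_even] := boolP (odd m).
  have [op opP] := idem_latin_prolong (half_Zp (m./2.-1)).
  have := idem_latin_ord opP; rewrite card_option card_ord.
  by have -> : (m./2.-1).*2.+3 = m by lia.
have := idem_latin_ord (idem_latin_half (half_Zp (m./2.-1))); rewrite card_ord.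
by have -> : (m./2.-1).*2.+3 = m.+1 by lia.
Qed.

End IdempotentLatinSquares.

(** * The square of order 2m + 3 and its blocks *)

Section Doubling.

Variables (m : nat) (op : 'I_m.+1 -> 'I_m.+1 -> 'I_m.+1).
Hypothesis op_idem_latin : idem_latin op.

Let S := option ('I_m.+1 * bool).

Let opL : forall a, injective (op a) := op_idem_latin.1.1.
Let opR : forall b, injective (op^~ b) := op_idem_latin.1.2.
Let opI : forall a, op a a = a := op_idem_latin.2.

(* For each i, the elements [None], [Some (i, false)], [Some (i, true)] form a copy of Z/3. *)
Definition dbl (x y : S) : S :=
  match x, y with
  | None, _ => y
  | _, None => x
  | Some (i, a), Some (i', b) =>
      if i == i' then if a == b then Some (i, ~~ a) else None
      else Some (op i i', a (+) b)
  end.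

Definition dbl_pair (x : S) : option 'I_m.+1 := omap fst x.

Definition dbl_swap (x : S) : S := omap (fun p => (p.1, ~~ p.2)) x.

(** An off-diagonal block with symbol pair j has row pair i different from j by idempotence, so the
    m such blocks are numbered through [lift j]. The other cells of pair j lie in the copy of Z/3 at
    j. *)
Definition dbl_block (j : 'I_m.+1) (x y : S) : option 'I_m :=
  match x, y with
  | Some (i, _), Some (i', _) => if i == i' then None else unlift j i
  | _, _ => None
  end.

Definition dbl_row (j : 'I_m.+1) (e : 'I_m) := lift j e.
Definition dbl_col (j : 'I_m.+1) (e : 'I_m) := invF (@opL (lift j e)) j.

Let op_idl i i' : op i i' = i -> i' = i.
Proof. by rewrite -{2}[i]opI => /opL. Qed.
Let op_idr i i' : op i i' = i' -> i = i'.
Proof. by rewrite -{2}[i']opI => /opR. Qed.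

Lemma latin_dbl : latin dbl.
Proof.
split.
- move=> [[i a]|] [[j b]|] [[j' b']|] //=.
  + case: (i =P j) => [<-|ij]; case: (i =P j') => [<-|ij'] //.
    * by move: a b b' => [] [] [] /=.
    * by case: ifP => // _ [/esym /op_idl /esym].
    * by case: ifP => // _ [/op_idl /esym].
    * by move=> [/opL -> /addbI ->].
  + by case: eqP => [<-|ij]; [move: a b => [] [] /= | move=> [/op_idl /esym]].
  + by case: eqP => [<-|ij]; [move: a b' => [] [] /= | move=> [/esym /op_idl /esym]].
- move=> [[i a]|] [[j b]|] [[j' b']|] //=.
  + case: (j =P i) => [->|ij]; case: (j' =P i) => [->|ij'] //.
    * by move: a b b' => [] [] [] /=.
    * by case: ifP => // _ [/esym /op_idr].
    * by case: ifP => // _ [/op_idr].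
    * by move=> [/opR -> /addIb ->].
  + by case: eqP => [->|ij]; [move: a b => [] [] /= | move=> [/op_idr]].
  + by case: eqP => [->|ij]; [move: a b' => [] [] /= | move=> [/esym /op_idr]].
Qed.

Lemma blocks_dbl : blocks dbl_pair dbl dbl_row dbl_col dbl_block.
Proof.
split; first exact: latin_dbl.
- move=> j [[i a]|] [[i1 b1]|] [[i2 b2]|] //=.
  + case: (i =P i1) => [_|ij]; case: (i =P i2) => [_|ij'] //=.
    * case: ifP => // _ [<-] [/op_idl /esym] //.
    * case: ifP => // _ [H] [H']; move: H; rewrite -H' => /op_idl /esym //.
  + case: eqP => [_|ij] // [H] [H']; move: H; rewrite -H' => /op_idl /esym //.
  + case: eqP => [_|ij] // [H] [H']; move: H'; rewrite -H => /op_idl /esym //.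
- move=> j [[i1 b1]|] [[i2 b2]|] [[i a]|] //=.
  + case: (i1 =P i) => [->|ij]; case: (i2 =P i) => [->|ij'] //=.
    * case: ifP => // _ [<-] [/op_idr] //.
    * case: ifP => // _ [H] [H']; move: H; rewrite -H' => /op_idr //.
    * by move=> [<-] [/opR ->].
  + case: eqP => [_|ij] //= [H] [H']; move: H; rewrite -H' => /op_idr //.
  + case: eqP => [_|ij] //= [H] [H']; move: H'; rewrite -H => /op_idr //.
- move=> j [[i a]|] [[i' b]|] //= e; case: eqP => // ij [opj].
  case: unliftP => // e' Ei [<-]; rewrite Ei in opj *; split=> //; congr Some.
  by apply: (@opL (lift j e')); rewrite [RHS]f_invF.
split.
- move=> j e [[i a]|] [[i' b]|] //= [->] [->].
  have opj : op (dbl_row j e) (dbl_col j e) = j by exact: f_invF.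
  have ij : dbl_row j e != dbl_col j e.
    apply/eqP => H; move: opj; rewrite -H opI => /eqP.
    by rewrite eq_sym (negbTE (neq_lift _ _)).
  by rewrite (negbTE ij) /= opj liftK.
- by move=> j; exists None, (Some (j, true)).
Qed.

Lemma swaps_dbl : swaps_pairs dbl_pair dbl_swap.
Proof.
split.
- by move=> [[i a]|] [[i' b]|] //= [-> /negb_inj ->].
- by move=> [[]|].
- by move=> [[i []]|] //= j _; apply/eqP => -[].
Qed.

(** Two more arguments, composed through a binary factor with m + 1 components, multiply the bound
    by m (m + 1). *)
Lemma has_colored_dbl n : 0 < n ->
  exists2 N, m ^ (n.-1 %/ 2) * m.+1 ^ (n %/ 2) <= N & has_colored dbl_pair n N.
Proof.
have c1 : has_colored dbl_pair 1 1.
  by apply: has_colored1 => j; exists (Some (j, true)).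
have c2 : has_colored dbl_pair 2 m.+1.
  by have := has_colored_star blocks_dbl _ _ c1 c1; rewrite !muln1 card_ord; apply.
have [l] := ubnP n; elim: l n => // l IHl [|[|[|n]]] // n_l _.
- by exists 1.
- by exists m.+1; rewrite // mul1n.
have [|//|N le_N cN] := IHl n.+1; first lia.
exists (m * N * m.+1).+1; last first.
  have := has_colored_star blocks_dbl _ _ cN c2.
  by rewrite card_ord addn2; apply.
have -> : n.+3.-1 %/ 2 = (n.+1.-1 %/ 2).+1 by lia.
have -> : n.+3 %/ 2 = (n.+1 %/ 2).+1 by lia.
rewrite !expnS; apply: leqW; nia.
Qed.

End Doubling.

(** * Switching combined with permutations of two arguments *)

Section Isotopes.

Variables (S J : finType) (pi : S -> option J) (sw : S -> S).

Lemma nquasi_perm n (F : (nat -> S) -> S) (s : nat -> {perm S}) :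
  nquasi n F -> nquasi n (fun x => F (fun i => s i (x i))).
Proof.
move=> [dF iF]; split=> [x y xy|i x y ilt xy /(iF _ _ _ ilt)].
  by apply: dF => i ilt; rewrite xy.
by move=> /(_ (fun j ji => congr1 (s j) (xy j ji))) /perm_inj.
Qed.

Let perms01 (p : {perm S} * {perm S}) (i : nat) : {perm S} :=
  if i == 0 then p.1 else if i == 1 then p.2 else 1%g.

(* Freezing the components that meet two lines through a point makes all the
   switched quasigroups coincide there, so that the permutations of the first
   two arguments can be recovered from the values on these lines. *)
Lemma Q_ge_switch_perm n N :
  swaps_pairs pi sw -> 0 < #|S| -> 1 < n -> has_colored pi n N ->
  #|S|`! * #|S|.-1`! * 2 ^ (#|J| * (N - 2)) <= Q n #|S|.
Proof.
move=> swP S_gt0 n_gt1 [C [F [col [Fcol <-]]]].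
have /card_gt0P [s0 _] := S_gt0.
pose line i t := set_coord (fun=> s0) i t.
pose met i := [set p : J * C |
  [exists t, (pi (F (line i t)) == Some p.1) && (col p.1 (line i t) == p.2)]].
(* Colours are constant along a line, so it meets at most one component per pair. *)
have card_met i : #|met i| <= #|J|.
  apply: (leq_card_in fst) => -[j c] [j' c'] /=; rewrite !inE /=.
  move=> /existsP [t /andP [/eqP Ft /eqP <-]] /existsP [t' /andP [/eqP Ft' /eqP <-]] jj'.
  move: Ft'; rewrite -jj' => Ft'.
  have [_ _ lcol _] := Fcol.
  by rewrite (lcol _ _ _ _ (@agree_off_set_coord _ _ _ t t') Ft Ft').
pose free := ~: (met 0 :|: met 1).
have card_free : #|J| * (#|C| - 2) <= #|free|.
  have := cardsC (met 0 :|: met 1); rewrite card_prod -/free.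
  have [+ _] := leq_card_setU (met 0) (met 1); have := card_met 0; have := card_met 1.
  by rewrite mulnBr; lia.
have switch_line (D : {set J * C}) i t : D \subset free -> i < 2 ->
    switch pi sw F col D (line i t) = F (line i t).
  move=> /subsetP Dfree i_lt2; rewrite /switch; case Ft: (pi _) => [j|//].
  case: ifP => // /Dfree; rewrite !inE negb_or => /andP [/existsP m0 /existsP m1].
  by case: i i_lt2 Ft m0 m1 => [|[|//]] _ Ft m0 m1; [case: m0 | case: m1]; exists t; rewrite Ft !eqxx.
pose Phi (p : {perm S} * {perm S} * {set J * C}) x :=
  switch pi sw F col p.2 (fun i => perms01 p.1 i (x i)).
pose fix0 := [set s : {perm S} | perm_on (~: [set s0]) s].
pose all0 := [set s : {perm S} | perm_on [set: S] s].
have card_A : #|setX (setX all0 fix0) (powerset free)| =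
    #|S|`! * #|S|.-1`! * 2 ^ #|free|.
  by rewrite !cardsX card_powerset !cardsE !card_perm cardsT cardsC1.
apply: leq_trans (Q_ge_card (Phi := Phi) (n := n)
  (A := setX (setX all0 fix0) (powerset free)) S_gt0 _ _).
- by rewrite card_A leq_mul2l leq_exp2l // card_free orbT.
- by move=> p _; apply: nquasi_perm; apply: nquasi_switch Fcol.
have [[dF iF] _ _ _] := Fcol.
move=> [[s1 s2] D] [[r1 r2] D']; rewrite !inE /=.
move=> /andP[/andP[_ s2P] DP] /andP[/andP[_ r2P] D'P] eqPhi.
have dS D0 : depends_below n (switch pi sw F col D0) by case: (nquasi_switch D0 swP Fcol).
have fixs0 s : perm_on (~: [set s0]) s -> s s0 = s0.
  by move=> sP; apply: out_perm sP _; rewrite !inE eqxx.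
have line0E p t : perm_on (~: [set s0]) p.2 ->
    (fun i => perms01 p i (line 0 t i)) =1 line 0 (p.1 t).
  by move=> /fixs0 pP [|[|i]] //=; rewrite /perms01 /= perm1.
have eq1 : s1 = r1.
  apply/permP => t; have := eqPhi (line 0 t).
  rewrite /Phi !(depends_ext (dS _) (line0E (_, _) t _)) //= !switch_line //.
  by move/(iF 0 _ _ (ltnW n_gt1) (@agree_off_set_coord _ _ _ _ _)).
move: eq1 eqPhi => <- eqPhi.
have eq2 : s2 = r2.
  pose x t := set_coord (line 0 ((s1^-1)%g s0)) 1 t.
  have xE q t : (fun i => perms01 (s1, q) i (x t i)) =1 line 1 (q t).
    by move=> [|[|i]] //=; rewrite /perms01 /= ?perm1 // /x /line /set_coord /= permKV.
  apply/permP => t; have := eqPhi (x t).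
  rewrite /Phi !(depends_ext (dS _) (xE _ t)) //= !switch_line //.
  by move/(iF 1 _ _ n_gt1 (@agree_off_set_coord _ _ _ _ _)).
move: eq2 eqPhi => <- eqPhi; congr (_, _).
apply: switch_inj swP Fcol _ => y.
pose x i := (perms01 (s1, s2) i)^-1%g (y i).
have xE : (fun i => perms01 (s1, s2) i (x i)) =1 y by move=> i; rewrite permKV.
by have := eqPhi x; rewrite /Phi /= !(depends_ext (dS _) xE).
Qed.

End Isotopes.

(** * Order five *)

Section OrderFive.

(* Rows, columns and symbols 0, 1 form a subsquare. *)
Definition table5 : seq (seq nat) :=
  [:: [:: 0; 1; 2; 3; 4]; [:: 1; 0; 3; 4; 2]; [:: 2; 3; 4; 0; 1];
      [:: 3; 4; 1; 2; 0]; [:: 4; 2; 0; 1; 3]].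

Definition op5 (a b : 'I_5) : 'I_5 := inord (nth 0 (nth [::] table5 a) b).

Definition pair5 (a : 'I_5) : option unit := if a < 2 then Some tt else None.

Definition swap5 (a : 'I_5) : 'I_5 := tperm (inord 0) (inord 1) a.

Definition block5 (_ : unit) (a b : 'I_5) : option unit :=
  if (a < 2) && (b < 2) then Some tt else None.

Lemma val_op5 a b : op5 a b = nth 0 (nth [::] table5 a) b :> nat.
Proof.
rewrite inordK //.
by case: a b => [[|[|[|[|[|//]]]]] ?] [[|[|[|[|[|//]]]]] ?].
Qed.

Lemma latin_op5 : latin op5.
Proof.
split=> [a b b'|b a a'] /(congr1 val); rewrite /= !val_op5 => H; apply: val_inj; move: H.
  by case: a b b' => [[|[|[|[|[|//]]]]] ?] [[|[|[|[|[|//]]]]] ?] [[|[|[|[|[|//]]]]] ?].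
by case: b a a' => [[|[|[|[|[|//]]]]] ?] [[|[|[|[|[|//]]]]] ?] [[|[|[|[|[|//]]]]] ?].
Qed.

(** The subsquare uses up the symbols 0 and 1 in its rows and columns, so elsewhere they occur only
    in the opposite 3 x 3 corner. *)
Lemma op5_lt2 a b : op5 a b < 2 -> (a < 2) = (b < 2).
Proof.
rewrite val_op5.
by case: a b => [[|[|[|[|[|//]]]]] ?] [[|[|[|[|[|//]]]]] ?].
Qed.

Lemma lt2_op5 (a b : 'I_5) : a < 2 -> b < 2 -> op5 a b < 2.
Proof.
rewrite val_op5.
by case: a b => [[|[|[|[|[|//]]]]] ?] [[|[|[|[|[|//]]]]] ?].
Qed.

Lemma blocks5 : blocks pair5 op5 (fun _ _ => tt) (fun _ _ => tt) block5.
Proof.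
have pairP a : pair5 a = Some tt <-> a < 2 by rewrite /pair5; case: ifP.
split; first exact: latin_op5.
- move=> [] a b b' /pairP /op5_lt2 ab /pairP /op5_lt2 ab'.
  by rewrite /block5 -ab -ab'.
- move=> [] a a' b /pairP /op5_lt2 ab /pairP /op5_lt2 ab'.
  by rewrite /block5 ab ab'.
- by move=> [] a b [] _; rewrite /block5; case: ifP => // /andP[? ?] _; split; apply/pairP.
split.
- move=> [] [] a b /pairP a2 /pairP b2; split; first exact/pairP/lt2_op5.
  by rewrite /block5 a2 b2.
- move=> []; exists (inord 2), (inord 3); split; first by apply/pairP; rewrite val_op5 !inordK.
  by rewrite /block5 !inordK.
Qed.

Lemma swaps5 : swaps_pairs pair5 swap5.
Proof.
split; first exact: perm_inj.
- by move=> s; rewrite /swap5; case: tpermP => [->|->|//]; rewrite /pair5 !inordK.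
- move=> s j; rewrite /pair5; case: ifP => // s2 _; rewrite /swap5.
  case: tpermP => [->|->|]; try by rewrite -val_eqE /= !inordK.
  move=> /eqP; rewrite -val_eqE /= inordK // => s0 /eqP; rewrite -val_eqE /= inordK //.
  by case: s s0 s2 => [[|[|]]].
Qed.

Lemma has_colored5 n : 0 < n -> exists2 N, 2 ^ (n %/ 2).+1 <= N + 8 & has_colored pair5 n N.
Proof.
have star n1 n2 N1 N2 : 0 < n1 -> 0 < n2 -> has_colored pair5 n1 N1 ->
    has_colored pair5 n2 N2 -> has_colored pair5 (n1 + n2) (N1 * N2).+1.
  by move=> ? ? c1 c2; have := has_colored_star blocks5 _ _ c1 c2;
    rewrite card_unit mul1n; apply.
have c1 : has_colored pair5 1 1.
  by apply: has_colored1 => -[]; exists (inord 0); rewrite /pair5 inordK.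
have c2 := star 1 1 _ _ isT isT c1 c1.
have c3 := star 2 1 _ _ isT isT c2 c1.
have c4 := star 2 2 _ _ isT isT c2 c2.
have add4 l N : has_colored pair5 l.+1 N -> has_colored pair5 l.+1.+4 (N * 5).+1.
  by move=> c; have := star l.+1 4 _ _ isT isT c c4; rewrite addn4.
have [l] := ubnP n; elim: l n => // l IHl.
move=> [|[|[|[|[|[|[|[|[|[|[|[|n]]]]]]]]]]]] // n_l _.
- by exists 1.
- by exists 2.
- by exists 3.
- by exists 5.
- by exists 6; last exact: add4 c1.
- by exists 11; last exact: add4 c2.
- by exists 16; last exact: add4 c3.
- by exists 26; last exact: add4 c4.
- by exists 31; last exact: add4 (add4 _ _ c1).
- by exists 56; last exact: add4 (add4 _ _ c2).
- by exists 81; last exact: add4 (add4 _ _ c3).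
have [|//|N le_N cN] := IHl n.+4.+4; first lia.
exists (N * 5).+1; last exact: add4 cN.
have -> : n.+4.+4.+4 %/ 2 = (n.+4.+4 %/ 2).+2 by lia.
(* With X the power of 2 for the previous arity, 5N + 9 >= 5X - 31 >= 4X once X >= 31; this is why
   the induction starts only at arity 12. *)
have : 2 ^ 5 <= 2 ^ (n.+4.+4 %/ 2).+1 by rewrite leq_exp2l //; lia.
by rewrite !expnS in le_N *; lia.
Qed.

Lemma Q5_ge n : 1 < n -> 2 ^ (2 ^ ((n + 2) %/ 2)) <= Q n 5.
Proof.
move=> n_gt1; have [|N le_N cN] := @has_colored5 n; first lia.
have := Q_ge_switch_perm swaps5 _ n_gt1 cN.
rewrite card_ord card_unit mul1n => /(_ isT); apply: leq_trans.
have -> : (n + 2) %/ 2 = (n %/ 2).+1 by lia.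
(* Since 5! 4! = 2880 >= 2^11, the permutations outweigh the deficit 8 and the two frozen
   components. *)
apply: (@leq_trans (2 ^ (11 + (N - 2)))); first by rewrite leq_exp2l //; lia.
by rewrite expnD leq_mul2r; apply/orP; right.
Qed.

End OrderFive.

(** * The bound for all odd orders and its comparison with the real exponent *)

Lemma Nat_powE a b : Nat.pow a b = a ^ b.
Proof. by elim: b => //= b ->; rewrite expnS. Qed.

(** For m > 1 the m + 1 pairs supply one more factor m + 1, which raises its exponent from
    floor(n/2) to floor(n/2) + 1. *)
Lemma Q_odd_ge m n : 0 < m -> 1 < n ->
  2 ^ (m ^ ((n - 1) %/ 2) * m.+1 ^ ((n + 2) %/ 2)) <= Q n m.*2.+3.
Proof.
move=> m_gt0 n_gt1; have [m1|m_gt1] : m = 1 \/ 1 < m by lia.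
  by rewrite m1 exp1n mul1n; apply: Q5_ge.
have [op opP] := exists_idem_latin m_gt1.
have [|N le_N cN] := has_colored_dbl opP (n := n); first lia.
have := Q_ge_switch (@swaps_dbl m) _ cN.
rewrite card_option card_prod card_bool !card_ord (_ : (m.+1 * 2).+1 = m.*2.+3); last lia.
move=> /(_ isT); apply: leq_trans; rewrite leq_exp2l // subn1.
have -> : (n + 2) %/ 2 = (n %/ 2).+1 by lia.
by rewrite expnS mulnCA leq_mul2l le_N orbT.
Qed.

(* From here on [^] on nat is [Nat.pow] and no longer [expn]. *)
From Stdlib Require Import Reals.

(** With d = b - n/2 > 0, both exponents on the left are a + d; shifting d from base m to base m + 1
    strictly increases the product. *)
Lemma Rpower_balance (m a b n : nat) : 0 < m -> a + b = n -> n < b.*2 ->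
  (Rpower (INR m) (INR n / 2) * Rpower (INR m.+1) (INR n / 2)
   < INR (m ^ a * m.+1 ^ b))%R.
Proof.
move=> m_gt0 abn nb.
have INR_exp x y : 0 < x -> INR (x ^ y) = Rpower (INR x) (INR y).
  move=> x_gt0; rewrite pow_INR Rpower_pow //.
  by apply: lt_0_INR; lia.
have m0 : (0 < INR m)%R by apply: lt_0_INR; lia.
have nE : INR n = (INR a + INR b)%R by rewrite -plus_INR; congr INR; lia.
have nb' : (INR n < 2 * INR b)%R.
  by have := lt_INR n b.*2 ltac:(lia); rewrite -mul2n mult_INR.
rewrite mult_INR !INR_exp //.
have [d [d0 -> ->]] : exists d : R,
    [/\ 0 < d, INR b = INR a + d + d & INR n / 2 = INR a + d]%R.
  by exists (INR b - INR n / 2)%R; split; Lra.lra.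
rewrite !Rpower_plus.
have lt : (Rpower (INR m) d < Rpower (INR m.+1) d)%R.
  by apply: Rlt_Rpower_l => //; split=> //; rewrite S_INR; Lra.lra.
have Rp x y : (0 < Rpower x y)%R by exact: exp_pos.
rewrite !Rmult_assoc; apply: Rmult_lt_compat_l; first exact: Rp.
rewrite (Rmult_comm (Rpower (INR m) d)) Rmult_assoc.
apply: Rmult_lt_compat_l; first exact: Rp.
by apply: Rmult_lt_compat_l => //; exact: Rp.
Qed.

(* k odd, k >= 5, so (k-3)/2 and (k-1)/2 are exact natural numbers. *)
Theorem theorem2 (k n : nat) (hk5 : 5 <= k) (hkodd : odd k) (hn : 2 <= n) :
  2 ^ (((k - 3) %/ 2) ^ ((n - 1) %/ 2) * ((k - 1) %/ 2) ^ ((n + 2) %/ 2)) <= Q n k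
  /\
  (Rpower 2 (Rpower (INR ((k - 3) %/ 2)) (INR n / 2) *
             Rpower (INR ((k - 1) %/ 2)) (INR n / 2))
   < INR (2 ^ (((k - 3) %/ 2) ^ ((n - 1) %/ 2) * ((k - 1) %/ 2) ^ ((n + 2) %/ 2)))
  )%R.
Proof.
set m := (k - 3) %/ 2; have -> : (k - 1) %/ 2 = m.+1 by lia.
have m_gt0 : 0 < m by lia.
split; first by rewrite !Nat_powE (_ : k = m.*2.+3); [exact: Q_odd_ge | lia].
rewrite pow_INR -Rpower_pow; last by rewrite /=; Lra.lra.
apply: Rpower_lt; first by rewrite /=; Lra.lra.
(* The two integer exponents sum to n, and the larger base has more than half. *)
by apply: Rpower_balance => //; lia.
Qed.
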